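(* Let $r\geq5$ be odd, let $I\subseteq\{1,\ldots,r-1\}$, with the convention $c_\varnothing=d_\varnothing=w_0$, and let $1\leq a\leq r$. Then $$s_ac_I\text{ is rational}\iff (a\leq r-2\text{ and }a+1\in I)\ \text{or}\ a=r-1\ \text{or}\ (a=r\text{ and }I=\varnothing),$$ $$s_ad_I\text{ is rational}\iff (a\leq r-2\text{ and }a+1\in I)\ \text{or}\ a=r\ \text{or}\ (a=r-1\text{ and }I=\varnothing).$$ In every rational case the resulting element belongs to $\mathcal F_r=\{w_0\}\cup\{c_J,d_J:\varnothing\neq J\subseteq\{1,\ldots,r-1\}\}$. More explicitly: if $1\leq a\leq r-2$ and $a+1\in I$, then $s_ac_I=c_{I\triangle\{a\}}$ and $s_ad_I=d_{I\triangle\{a\}}$; moreover $s_{r-1}c_I=c_{I\triangle\{r-1\}}$ and $s_rd_I=d_{I\triangle\{r-1\}}$; and $s_{r-1}w_0=c_{\{r-1\}}$, $s_rw_0=d_{\{r-1\}}$. Consequently, if $v\in\mathcal F_r$ and $s_av$ is rational, then $s_av\in\mathcal F_r$.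
   Context: Root system and group. Let $e_1,\ldots,e_r$ be the standard orthonormal basis of $\mathbb R^r$. $W(D_r)$ is the group of linear maps $u$ with $u(e_j)=\varepsilon_j e_{\pi(j)}$, $\pi\in S_r$, $\varepsilon_j\in\{\pm1\}$, with an even number of negative signs $\varepsilon_j$. Positive roots: $\Pi_+=\{e_i-e_j,\ e_i+e_j:1\leq i<j\leq r\}$. Simple roots: $\alpha_i=e_i-e_{i+1}$ ($1\leq i\leq r-1$), $\alpha_r=e_{r-1}+e_r$; $s_a$ is the reflection in $\alpha_a$. Root order: $\rho\leq\eta$ iff $\eta-\rho\in\sum_{a=1}^r\mathbb Z_{\geq0}\alpha_a$. The longest element $w_0$ is given by $w_0(e_i)=-e_i$ ($1\leq i\leq r-1$), $w_0(e_r)=e_r$. Rationality. For $S\subseteq\Pi_+$ let $\operatorname{Adj}(S)=\{\gamma\in\Pi_+:\gamma\leq\beta\text{ for some }\beta\in S\}$. For $u\in W(D_r)$ let $\nu_0(u)=u(\Pi_+)\cap\Pi_+$ and $\nu_k(u)=u(\operatorname{Adj}(\nu_{k-1}(u)))\cap\Pi_+$ for $k\geq1$. The element $u$ is rational if $\nu_k(u)=\varnothing$ for all sufficiently large $k$. Signed cyclic elements. For $\varnothing\neq I=\{i_1<\cdots<i_k\}\subseteq\{1,\ldots,r-1\}$ let $p_I\in S_r$ be given by $p_I(i_a)=i_{a+1}$ ($1\leq a<k$), $p_I(i_k)=r$, $p_I(r)=i_1$, and $p_I(j)=j$ for $j\notin I\cup\{r\}$. Define $c_I,d_I\in W(D_r)$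 by $c_I(e_j)=-e_{p_I(j)}$ ($1\leq j\leq r-1$), $c_I(e_r)=e_{i_1}$; and $d_I(e_j)=-e_{p_I(j)}$ ($j\in\{1,\ldots,r-1\}\setminus\{i_k\}$), $d_I(e_{i_k})=e_r$, $d_I(e_r)=-e_{i_1}$. $\triangle$ denotes symmetric difference. *)

(* Defs.v *)
From HB Require Import structures.
From mathcomp Require Import all_boot all_order all_algebra all_fingroup.
From mathcomp Require Import finmap classical_sets reals.

Set Implicit Arguments.
Unset Strict Implicit.
Unset Printing Implicit Defensive.

Import Order.TTheory GRing.Theory Num.Theory.

Local Open Scope classical_set_scope.
Local Open Scope ring_scope.

(* All indices are the natural numbers 1, ..., r (1-based).  Linear maps of R^r
   are matrices acting on column vectors, u(v) = u *m v, so that the composite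
   "first v, then u" is u *m v. *)

Section TypeD.
Variables (R : realType) (r : nat).

(* The coordinate numbered j in 1, ..., r sits at position j - 1 of 'I_r. *)
Definition evec (j : nat) : 'cV[R]_r := \col_(i < r) (i.+1 == j)%:R.

(* The linear map sending evec j to f j for 1 <= j <= r, see lin_of_basisE. *)
Definition lin_of_basis (f : nat -> 'cV[R]_r) : 'M[R]_r :=
  \matrix_(i < r, j < r) f j.+1 i 0.

Definition WD : set 'M[R]_r :=
  [set u | exists (p : 'S_r) (eps : 'I_r -> bool),
     ~~ odd #|[pred j | eps j]| /\
     forall j : 'I_r, u *m evec j.+1 = (-1) ^+ (eps j) *: evec (p j).+1].

Definition pos_roots : set 'cV[R]_r :=
  [set v | exists i j : nat, [/\ (1 <= i)%N, (i < j)%N, (j <= r)%N &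
     v = evec i - evec j \/ v = evec i + evec j]].

Definition simple_root (a : nat) : 'cV[R]_r :=
  if a == r then evec r.-1 + evec r else evec a - evec a.+1.

Definition root_le (rho eta : 'cV[R]_r) : Prop :=
  exists n : nat -> nat, eta - rho = \sum_(1 <= a < r.+1) simple_root a *+ n a.

Definition dot (u v : 'cV[R]_r) : R := \sum_(i < r) u i 0 * v i 0.

Definition reflection (alpha v : 'cV[R]_r) : 'cV[R]_r :=
  v - (2 * dot v alpha / dot alpha alpha) *: alpha.

Definition srefl (a : nat) : 'M[R]_r :=
  lin_of_basis (fun j => reflection (simple_root a) (evec j)).

Definition w0 : 'M[R]_r :=
  lin_of_basis (fun j => if j == r then evec r else - evec j).

Definition Adj (S : set 'cV[R]_r) : set 'cV[R]_r :=
  [set g | pos_roots g /\ exists2 b, S b & root_le g b].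

Fixpoint nu (k : nat) (u : 'M[R]_r) : set 'cV[R]_r :=
  match k with
  | 0%N => ((fun v => u *m v) @` pos_roots) `&` pos_roots
  | k'.+1 => ((fun v => u *m v) @` Adj (nu k' u)) `&` pos_roots
  end.

(* Meant for u in WD; the maps it is applied to are products of srefl a, w0,
   cI I and dI I, which lie in WD by srefl_WD, w0_WD, cI_WD, dI_WD, WD_mul. *)
Definition is_rational (u : 'M[R]_r) : Prop :=
  exists N : nat, forall k : nat, (N <= k)%N -> nu k u = set0.

(* A set I of indices, listed increasingly as i_1 < ... < i_k. *)
Definition listing (I : {fset nat}) : seq nat := sort leq I.

Definition first_index (I : {fset nat}) : nat := head 0%N (listing I).
Definition last_index (I : {fset nat}) : nat := last 0%N (listing I).

(* The cycle i_1 -> i_2 -> ... -> i_k -> r -> i_1; [next] fixes every index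
   outside the given list. *)
Definition pI (I : {fset nat}) (j : nat) : nat := next (rcons (listing I) r) j.

Definition cI (I : {fset nat}) : 'M[R]_r :=
  if I == fset0 then w0 else
  lin_of_basis (fun j => if j == r then evec (first_index I) else - evec (pI I j)).

Definition dI (I : {fset nat}) : 'M[R]_r :=
  if I == fset0 then w0 else
  lin_of_basis (fun j => if j == r then - evec (first_index I)
                         else if j == last_index I then evec r
                         else - evec (pI I j)).

Definition index_set (I : {fset nat}) : Prop :=
  forall i, i \in I -> (1 <= i <= r.-1)%N.

Definition Fr : set 'M[R]_r :=
  [set u | u = w0 \/
     exists J : {fset nat}, [/\ J != fset0, index_set J & u = cI J \/ u = dI J]].

Lemma lin_of_basisE (f : nat -> 'cV[R]_r) (j : nat) :
  (1 <= j <= r)%N -> lin_of_basis f *m evec j = f j.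
Proof.
case: j => // j /= ltjr; apply/matrixP => i k; rewrite ord1 !mxE.
rewrite (bigD1 (Ordinal ltjr)) //= !mxE eqxx mulr1 big1 ?addr0 // => l ne.
rewrite !mxE eqSS; case: eqP => [E|_]; last by rewrite mulr0.
by case/eqP: ne; apply: val_inj.
Qed.

End TypeD.

Definition symdiff (A B : {fset nat}) : {fset nat} :=
  ((A `\` B) `|` (B `\` A))%fset.

Section Membership.
Variables (R : realType) (r : nat).
Local Notation evec := (@evec R r).

Lemma sreflE a (v : 'cV[R]_r) : srefl R r a *m v = reflection (simple_root R r a) v.
Proof.
set al := simple_root R r a.
have ev : v = \sum_(j < r) v j 0 *: evec j.+1.
  apply/matrixP => i k; rewrite ord1 summxE (bigD1 i) //= !mxE eqxx mulr1.
  rewrite big1 ?addr0 // => l ne; rewrite !mxE eqSS.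
  by case: eqP => [E|_]; [case/eqP: ne; apply: val_inj | rewrite mulr0].
have dots : dot v al = \sum_(j < r) v j 0 * dot (evec j.+1) al.
  apply: eq_bigr => j _; congr (_ * _).
  rewrite /dot (bigD1 j) //= !mxE eqxx mul1r big1 ?addr0 // => l ne.
  rewrite !mxE eqSS; case: eqP => [E|_]; last by rewrite mul0r.
  by case/eqP: ne; apply: val_inj.
rewrite {1}ev mulmx_sumr /reflection dots mulr_sumr mulr_suml scaler_suml.
rewrite {2}ev -sumrB; apply: eq_bigr => j _.
rewrite -scalemxAr lin_of_basisE //= /reflection -/al scalerBr scalerA.
by congr (_ - _ *: _); rewrite !mulrA (mulrC _ 2).
Qed.

Lemma WD_mul (u v : 'M[R]_r) : WD u -> WD v -> WD (u *m v).
Proof.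
move=> [p [ep [evp up]]] [q [eq' [evq vq]]].
exists (q * p)%g, (fun j => ep (q j) (+) eq' j); split; last first.
  move=> j; rewrite -mulmxA vq -scalemxAr up scalerA permM.
  by rewrite signr_addb mulrC.
have E (f : 'I_r -> bool) : odd #|[pred j | f j]| = \big[addb/false]_j f j.
  rewrite -sum1_card (big_morph odd oddD (erefl _)) big_mkcond /=.
  by apply: eq_bigr => j _; rewrite unfold_in /=; case: (f j).
rewrite E big_split /= -(E eq') (negbTE evq) addbF.
by rewrite -(reindex_inj (@perm_inj _ q) (F := ep) (P := xpredT)) -E.
Qed.

Lemma listing_uniq (I : {fset nat}) : index_set r I -> uniq (rcons (listing I) r).
Proof.
move=> hI; rewrite rcons_uniq sort_uniq fset_uniq andbT mem_sort.
apply/negP => /hI; case: (r) => //= n; by rewrite ltnn.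
Qed.

Lemma pI_range (I : {fset nat}) j : index_set r I -> (0 < r)%N ->
  (1 <= j <= r)%N -> (1 <= pI r I j <= r)%N.
Proof.
move=> hI r0 hj; rewrite /pI.
have [jI|jI] := boolP (j \in rcons (listing I) r); last first.
  by rewrite next_nth (negbTE jI).
move: jI; rewrite -mem_next mem_rcons inE mem_sort => /orP[/eqP ->|/hI].
  by rewrite r0 leqnn.
by case/andP => -> h; apply: (leq_trans h); rewrite leq_pred.
Qed.

Lemma pI_inj (I : {fset nat}) : index_set r I -> injective (pI r I).
Proof. by move=> hI; apply: (can_inj (prev_next (listing_uniq hI))). Qed.

Lemma WD_signed_perm (p : nat -> nat) (eps : nat -> bool) :
  (forall j, (1 <= j <= r)%N -> (1 <= p j <= r)%N) ->
  {in [pred j | (1 <= j <= r)%N] &, injective p} ->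
  ~~ odd (count eps (iota 1 r)) ->
  WD (lin_of_basis (fun j => (-1) ^+ (eps j) *: evec (p j))).
Proof.
move=> hp pinj hev.
have lt (j : 'I_r) : ((p j.+1).-1 < r)%N.
  have /hp/andP[h1 h2] : (1 <= j.+1 <= r)%N by rewrite /=.
  by rewrite prednK.
have inj : injective (fun j : 'I_r => Ordinal (lt j)).
  move=> i j /(congr1 val) /= E; apply/val_inj/succn_inj.
  apply: pinj; rewrite ?inE /= ?ltn_ord //.
  have /hp/andP[hi _] : (1 <= i.+1 <= r)%N by rewrite /=.
  have /hp/andP[hj _] : (1 <= j.+1 <= r)%N by rewrite /=.
  by rewrite -(prednK hi) -(prednK hj) E.
exists (perm inj), (fun j => eps j.+1); split; last first.
  move=> j; rewrite lin_of_basisE //= permE /=.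
  have /hp/andP[hj _] : (1 <= j.+1 <= r)%N by rewrite /=.
  by rewrite prednK.
rewrite -(addn0 1%N) iotaDl count_map -val_enum_ord count_map in hev.
by rewrite cardE /enum_mem size_filter -enumT.
Qed.

Lemma lin_of_basis_ext (f g : nat -> 'cV[R]_r) :
  (forall j, (1 <= j <= r)%N -> f j = g j) -> lin_of_basis f = lin_of_basis g.
Proof. by move=> fg; apply/matrixP => i j; rewrite !mxE fg //= ltn_ord. Qed.

Lemma even_neg (x : nat) : odd r -> (1 <= x <= r)%N ->
  ~~ odd (count (predC1 x) (iota 1 r)).
Proof.
move=> ro hx; have := count_predC (pred1 x) (iota 1 r).
rewrite size_iota (count_uniq_mem x (iota_uniq 1 r)) mem_iota add1n ltnS hx.
by move=> E; move: ro; rewrite -{1}E oddD; exact: id.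
Qed.

Lemma w0_WD : odd r -> WD (w0 R r).
Proof.
move=> ro; rewrite /w0.
rewrite (lin_of_basis_ext (g := fun j => (-1) ^+ (predC1 r j) *: evec j)).
  apply: (@WD_signed_perm id) => //.
  by apply: even_neg; rewrite ?leqnn ?andbT; case: (r) ro.
move=> j _ /=; case: eqP => [->|_] /=; by rewrite ?scale1r ?scaleN1r.
Qed.

Lemma listing_neq0 (I : {fset nat}) : I != fset0 -> listing I != [::].
Proof. by rewrite -size_eq0 size_sort cardfs_eq0. Qed.

Lemma pI_r (I : {fset nat}) : index_set r I -> I != fset0 ->
  pI r I r = first_index I.
Proof.
move=> /listing_uniq; rewrite /pI /first_index => + /listing_neq0.
case: (listing I) => // x t; rewrite rcons_cons => u _.
have [xr rt] : x != r /\ r \notin t.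
  move: u => /= /andP[]; rewrite mem_rcons inE negb_or rcons_uniq.
  by move=> /andP[? _] /andP[].
rewrite next_nth inE mem_rcons inE eqxx orbT /= (negbTE xr) -cats1 index_cat.
by rewrite (negbTE rt) /= eqxx addn0 nth_default // size_cat addn1.
Qed.

Lemma pI_last (I : {fset nat}) : index_set r I -> I != fset0 ->
  pI r I (last_index I) = r.
Proof.
move=> /listing_uniq; rewrite /pI /last_index => + /listing_neq0.
case: (lastP (listing I)) => //= t x u _; rewrite last_rcons.
have xt : x \notin t.
  by move: u; rewrite !rcons_uniq => /and3P[].
rewrite -!cats1 -catA; case: t xt {u} => [|y t]; first by rewrite /= eqxx.
rewrite inE negb_or => /andP[xy xt]; rewrite cat_cons next_nth.
rewrite inE mem_cat !inE eqxx !orbT /= eq_sym (negbTE xy) index_cat.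
by rewrite (negbTE xt) /= eqxx addn0 nth_cat ltnNge leqnSn /= subSnn.
Qed.

Lemma last_index_range (I : {fset nat}) : index_set r I -> I != fset0 ->
  (1 <= last_index I <= r.-1)%N.
Proof.
move=> hI /listing_neq0 h; apply: hI; rewrite -(mem_sort leq) /last_index.
by move: h; rewrite -/(listing I); case: (listing I) => //= x t _; apply: mem_last.
Qed.

Lemma cI_WD (I : {fset nat}) : odd r -> index_set r I -> WD (cI R r I).
Proof.
move=> ro hI; rewrite /cI; have [_|I0] := eqVneq; first exact: w0_WD.
have r0 : (0 < r)%N by case: (r) ro.
rewrite (lin_of_basis_ext (g := fun j => (-1) ^+ (predC1 r j) *: evec (pI r I j))).
  apply: WD_signed_perm; first by move=> j; apply: pI_range.
    by move=> ? ? _ _; apply: pI_inj.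
  by apply: even_neg; rewrite ?r0 /=.
move=> j _ /=; case: eqP => [->|_] /=; rewrite ?scale1r ?scaleN1r //.
by rewrite pI_r.
Qed.

Lemma dI_WD (I : {fset nat}) : odd r -> index_set r I -> WD (dI R r I).
Proof.
move=> ro hI; rewrite /dI; have [_|I0] := eqVneq; first exact: w0_WD.
have r0 : (0 < r)%N by case: (r) ro.
have /andP[l1 l2] := last_index_range hI I0.
rewrite (lin_of_basis_ext
  (g := fun j => (-1) ^+ (predC1 (last_index I) j) *: evec (pI r I j))).
  apply: WD_signed_perm; first by move=> j; apply: pI_range.
    by move=> ? ? _ _; apply: pI_inj.
  by apply: even_neg; rewrite ?l1 //= (leq_trans l2) ?leq_pred.
move=> j _ /=; case: (eqVneq j r) => [->|_] /=.
  have /negbTE -> : r != last_index I.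
    by apply: contraTneq l2 => <-; case: (r) r0 => // n _; rewrite /= ltnn.
  by rewrite scaleN1r pI_r.
by case: eqP => [->|_] /=; rewrite ?scale1r ?scaleN1r ?pI_last.
Qed.

Lemma dot_evec (i j : nat) : (1 <= i <= r)%N -> dot (evec i) (evec j) = (i == j)%:R.
Proof.
case: i => // i /= ir; rewrite /dot (bigD1 (Ordinal ir)) //= !mxE eqxx mul1r.
rewrite big1 ?addr0 // => l ne; rewrite !mxE eqSS.
case: eqP => [E|_]; last by rewrite mul0r.
by case/eqP: ne; apply: val_inj.
Qed.

Lemma dotDr (u v w : 'cV[R]_r) : dot u (v + w) = dot u v + dot u w.
Proof. by rewrite -big_split; apply: eq_bigr => i _; rewrite mxE mulrDr. Qed.

Lemma dotDl (u v w : 'cV[R]_r) : dot (u + v) w = dot u w + dot v w.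
Proof. by rewrite -big_split; apply: eq_bigr => i _; rewrite mxE mulrDl. Qed.

Lemma dotNr (u v : 'cV[R]_r) : dot u (- v) = - dot u v.
Proof. by rewrite -sumrN; apply: eq_bigr => i _; rewrite mxE mulrN. Qed.

Lemma dotNl (u v : 'cV[R]_r) : dot (- u) v = - dot u v.
Proof. by rewrite -sumrN; apply: eq_bigr => i _; rewrite mxE mulNr. Qed.

Definition transp (x y j : nat) : nat :=
  if j == x then y else if j == y then x else j.

Lemma srefl_minus (a : nat) : (1 <= a < r)%N ->
  srefl R r a = lin_of_basis (fun j => evec (transp a a.+1 j)).
Proof.
move=> /andP[a1 ar]; apply: lin_of_basis_ext => j hj.
have har : (1 <= a <= r)%N by rewrite a1 ltnW.
rewrite /reflection /simple_root (ltn_eqF ar) /transp.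
rewrite !(dotDr, dotDl, dotNr, dotNl) !dot_evec //.
rewrite !eqxx (ltn_eqF (ltnSn a)) (gtn_eqF (ltnSn a)) /=.
rewrite oppr0 addr0 add0r opprK.
rewrite -[1 + 1](natrD R 1 1) mulrAC divff ?pnatr_eq0 // mul1r.
case: (eqVneq j a) => [->|ja].
  by rewrite (ltn_eqF (ltnSn a)) subr0 scale1r opprB addrC subrK.
case: (eqVneq j a.+1) => [->|ja1].
  by rewrite sub0r scaleN1r opprK addrC subrK.
by rewrite subrr scale0r subr0.
Qed.

Lemma srefl_plus : (2 <= r)%N ->
  srefl R r r =
  lin_of_basis (fun j => (-1) ^+ (r.-1 <= j)%N *: evec (transp r.-1 r j)).
Proof.
move=> r2; apply: lin_of_basis_ext => j hj.
have r1r : (r.-1 < r)%N by rewrite ltn_predL ltnW.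
have hr : (1 <= r <= r)%N by rewrite leqnn ltnW.
have hr1 : (1 <= r.-1 <= r)%N by rewrite leq_pred -ltnS prednK ?r2 // ltnW.
rewrite /reflection /simple_root eqxx /transp.
rewrite !(dotDr, dotDl) !dot_evec //.
rewrite !eqxx (ltn_eqF r1r) (gtn_eqF r1r) /= addr0 add0r.
rewrite -[1 + 1](natrD R 1 1) mulrAC divff ?pnatr_eq0 // mul1r.
case: (eqVneq j r.-1) => [->|ja].
  by rewrite (ltn_eqF r1r) leqnn addr0 scale1r opprD addrA subrr sub0r scaleN1r.
case: (eqVneq j r) => [->|ja1].
  by rewrite leq_pred add0r scale1r opprD addrCA subrr addr0 scaleN1r.
rewrite addr0 scale0r subr0 leqNgt.
have -> : (j < r.-1)%N.
  by rewrite ltn_neqAle ja -ltnS prednK ?(ltnW r2) // ltn_neqAle ja1; case/andP: hj.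
by rewrite scale1r.
Qed.

Lemma srefl_WD (a : nat) : (2 <= r)%N -> (1 <= a <= r)%N -> WD (srefl R r a).
Proof.
move=> r2 /andP[a1 ar].
have tinj x y : injective (transp x y).
  apply: (can_inj (g := transp x y)) => j; rewrite /transp.
  have [->|jx] := eqVneq j x; first by have [->|_] := eqVneq y x; rewrite ?eqxx.
  have [->|jy] := eqVneq j y; first by rewrite eqxx.
  by rewrite (negbTE jx) (negbTE jy).
have trange x y j : (1 <= x <= r)%N -> (1 <= y <= r)%N -> (1 <= j <= r)%N ->
    (1 <= transp x y j <= r)%N.
  by move=> *; rewrite /transp; case: ifP => // _; case: ifP.
case: (ltnP a r) => [altr|rlea].
  rewrite srefl_minus ?a1 //.
  rewrite (lin_of_basis_ext
    (g := fun j => (-1) ^+ (pred0 j) *: evec (transp a a.+1 j))); last first.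
    by move=> j _; rewrite scale1r.
  apply: WD_signed_perm; last by rewrite count_pred0.
    by move=> j; apply: trange; rewrite ?a1.
  by move=> ? ? _ _; apply: tinj.
have -> : a = r by apply/eqP; rewrite eqn_leq ar.
rewrite srefl_plus //; apply: (@WD_signed_perm (transp r.-1 r) (fun j => r.-1 <= j)%N).
- by move=> j; apply: trange; rewrite ?leqnn ?leq_pred ?(ltnW r2) // andbT
    -ltnS prednK ?r2 // ltnW.
- by move=> ? ? _ _; apply: tinj.
have -> : iota 1 r = iota 1 (r - 2) ++ [:: r.-1; r].
  rewrite -{1}(subnK r2) iotaD /= add1n.
  by case: (r) r2 => // -[|n] // _; rewrite !subSS subn0.
rewrite count_cat /= leqnn leq_pred /= addn2 oddS oddS negbK.
rewrite (eq_in_count (a2 := pred0)) ?count_pred0 // => j.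
by rewrite mem_iota => /andP[_]; rewrite add1n -subSn // -subn1 => h;
  apply/negbTE; rewrite -ltnNge; move: h; case: (r) r2 => // -[|n] //= _; rewrite !subSS !subn0.
Qed.

End Membership.

(* Main.v *)
Require Import Defs.
From mathcomp Require Import all_boot all_order all_algebra.
From mathcomp Require Import finmap classical_sets reals.
From mathcomp Require Import zify.

Set Implicit Arguments.
Unset Strict Implicit.
Unset Printing Implicit Defensive.

Import Order.TTheory GRing.Theory Num.Theory.

Local Open Scope classical_set_scope.
Local Open Scope ring_scope.

(** The permutation [pI r I] is the cyclic successor map of the set I u {r}, and
with that reading [cI I] sends e_j to - e_(p j) for j < r and e_r to e_(p r),
also when I is empty.  Write L = I u {r}.

_Products._  Inserting a into L, or removing it, when a + 1 is in L and a < r,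
changes the successor map exactly by the transposition of a and a + 1: the
element whose successor was a + 1 gets the successor a, and a gets the successor
a + 1 ([transp_pI]).  Since s_a acts on the vectors e_j as this transposition,
s_a c_I = c_(I symdiff a) ([srefl_minus_cI]).

_Rationality of c_I._  The sets nu_k are decreasing, and for u = c_I they die at
k = 2.  A root e_i + e_j or e_i - e_j has a positive image only if that image
is a difference e_x - e_y ([nu0_cI]).  The positive roots below e_x - e_y are the
e_x' - e_y' with x <= x' < y' <= y ([root_le_minus]), and c_I keeps such a root
positive only if x' is in I and x' < y' < p x', the image being e_y' - e_(p x')
([cI_minus]).  Every root below this image starts strictly between x' and its
successor p x', hence outside I, and so it becomes negative.

_Non-rationality._  A positive root g with u g positive and g <= u g survives in
all the nu_k; more generally so does any set of positive roots recurring under u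
and the passage to lower roots ([not_rational_recurrent]).  If a <= r - 2 and a + 1
is not in I, then s_a c_I maps the simple root e_a - e_(a+1) to some e_a - e_y
with y > a, which is equal to it or above it.  If I is not empty, then s_r c_I maps
e_(r-1) + e_r to a larger root, except for I = {r - 1}, where it exchanges
e_(r-1) + e_r and e_(r-1) - e_r.

_From c to d._  The diagram automorphism [flip], e_r |-> - e_r, exchanges the
simple roots numbered r - 1 and r, fixes the others, and conjugates c_I to d_I.
It permutes the positive roots and preserves the order, so it preserves
rationality; every claim on d_I is the conjugate of one on c_I.  As w_0 is
both c_I and d_I for empty I, this also settles s_r w_0, which is d_J for
J = {r - 1}. *)

(** * The cyclic successor *)

(** The first alternative is the ordinary successor of [j] in I u {r}; the
second one is the step back from the greatest element to the least. *)
Definition cyclic_succ (r : nat) (I : {fset nat}) (j y : nat) : Prop :=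
  [/\ (y \in I) || (y == r) &
     ((j < y)%N /\ forall z, (z \in I) || (z == r) -> (z <= j)%N || (y <= z)%N)
     \/ (forall z, (z \in I) || (z == r) -> (y <= z <= j)%N)].

Lemma cyclic_succ_inj r I j y y' :
  cyclic_succ r I j y -> cyclic_succ r I j y' -> y = y'.
Proof.
move=> [Ly hy] [Ly' hy'].
case: hy => [[jy hy]|hy]; case: hy' => [[jy' hy']|hy'];
  move: (hy _ Ly') (hy' _ Ly); lia.
Qed.

(** On a strictly increasing list the cyclic [next] of ssreflect is the successor
for the order, which turns [pI] into an order-theoretic notion. *)
Lemma next_sorted (s : seq nat) x : sorted ltn s -> x \in s ->
  ((x < next s x)%N /\ (forall z, z \in s -> (z <= x)%N || (next s x <= z)%N))
   \/ (forall z, z \in s -> (next s x <= z <= x)%N).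
Proof.
move=> ss xs.
have le_nth i j : (j < size s)%N -> (i <= j)%N -> (nth 0%N s i <= nth 0%N s j)%N.
  move=> hj; rewrite leq_eqVlt => /orP[/eqP->//|ij].
  by apply/ltnW/(sorted_ltn_nth ltn_trans) => //; apply: ltn_trans hj.
have E : next s x = nth (head 0%N s) s (index x s).+1.
  by rewrite next_nth xs; case: (s) xs.
rewrite {}E; case/(nthP 0%N): xs => i hi <-.
rewrite index_uniq ?(sorted_uniq ltn_trans ltnn) //.
case: (ltnP i.+1 (size s)) => hi'; [left|right].
  rewrite (set_nth_default 0%N) //; split.
    exact: (sorted_ltn_nth ltn_trans).
  move=> _ /(nthP 0%N)[k hk <-]; case: (leqP k i) => ki.
    by rewrite le_nth.
  by rewrite orbC le_nth.
move=> _ /(nthP 0%N)[k hk <-]; rewrite nth_default // -nth0.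
by rewrite !le_nth //; apply: leq_trans hk hi'.
Qed.

Lemma pI_succ r I j : index_set r I -> (0 < r)%N -> (j \in I) || (j == r) ->
  cyclic_succ r I j (pI r I j).
Proof.
move=> hI r0 hj.
have mem z : (z \in rcons (listing I) r) = (z \in I) || (z == r).
  by rewrite mem_rcons inE mem_sort orbC.
have ss : sorted ltn (rcons (listing I) r).
  rewrite (sorted_pairwise ltn_trans) pairwise_rcons -(sorted_pairwise ltn_trans).
  rewrite ltn_sorted_uniq_leq sort_uniq fset_uniq (sort_sorted leq_total) !andbT.
  by apply/allP => z; rewrite mem_sort => /hI; lia.
have jL : j \in rcons (listing I) r by rewrite mem.
have h := next_sorted ss jL.
rewrite /cyclic_succ /pI -mem mem_next jL; split=> //.
case: h => [[lt h]|h]; [left; split=> // z|right=> z]; rewrite -mem; exact: h.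
Qed.

Lemma pI_out r I j : j \notin I -> j != r -> pI r I j = j.
Proof.
move=> jI jr; rewrite /pI next_nth mem_rcons inE mem_sort.
by rewrite (negbTE jr) (negbTE jI).
Qed.

Lemma in_symdiff1 I a z : (z \in symdiff I [fset a]%fset) = (z \in I) (+) (z == a).
Proof. by rewrite !inE; case: (z \in I); case: (z == a). Qed.

Lemma symdiff1K I a : symdiff (symdiff I [fset a]%fset) [fset a]%fset = I.
Proof. by apply/fsetP => z; rewrite !in_symdiff1 -addbA addbb addbF. Qed.

Lemma index_set_symdiff1 r I a : index_set r I -> (1 <= a < r)%N ->
  index_set r (symdiff I [fset a]%fset).
Proof.
move=> hI ha i; rewrite in_symdiff1.
by case: eqVneq => [->|_]; [lia|rewrite addbF; apply: hI].
Qed.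

(** * Symmetric differences and transpositions *)

Lemma transpK x y j : transp x y (transp x y j) = j.
Proof.
rewrite /transp; have [->|jx] := eqVneq j x; last first.
  by have [->|jy] := eqVneq j y; rewrite ?eqxx // (negbTE jx) (negbTE jy).
by have [->|_] := eqVneq y x; rewrite ?eqxx.
Qed.

(** Inserting a just before a + 1: the gap of I u {r} that ends at a + 1 is cut
into a gap ending at a and the gap from a to a + 1, and the other gaps are
unaffected.  Either kind of gap may be the one where the cycle wraps around. *)
Lemma transp_pI_insert r I a j : index_set r I -> (1 <= a < r)%N -> a \notin I ->
  (a.+1 \in I) || (a.+1 == r) -> (1 <= j <= r)%N ->
  transp a a.+1 (pI r I j) = pI r (symdiff I [fset a]%fset) j.
Proof.
move=> hI ha aI a1I hj.
have r0 : (0 < r)%N by lia.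
have hJ := index_set_symdiff1 hI ha.
have arF : (a == r) = false by lia.
have memJ z : ((z \in symdiff I [fset a]%fset) || (z == r)) =
    ((z \in I) || (z == r) || (z == a)).
  rewrite in_symdiff1; case: eqVneq => [->|_]; last by rewrite addbF orbF.
  by rewrite (negbTE aI) /= orbT.
have [jL|jL] := boolP ((j \in I) || (j == r)); last first.
  move: (jL); rewrite negb_or => /andP[jI jr]; rewrite (pI_out jI) //.
  have [ja|ja] := eqVneq j a; last first.
    rewrite pI_out //; last by rewrite in_symdiff1 (negbTE ja) addbF.
    rewrite /transp (negbTE ja) ifN //.
    by apply: contraNneq jL => ->.
  rewrite /transp ja eqxx.
  have jJ : (j \in symdiff I [fset a]%fset) || (j == r) by rewrite memJ ja eqxx orbT.
  rewrite ja in jJ; apply: cyclic_succ_inj (pI_succ hJ r0 jJ).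
  split; first by rewrite memJ a1I.
  by left; split=> // z _; lia.
have jJ : (j \in symdiff I [fset a]%fset) || (j == r) by rewrite memJ jL.
apply: cyclic_succ_inj (pI_succ hJ r0 jJ).
have ja : (j != a) by apply: contraTneq jL => ->; rewrite (negbTE aI) arF.
have [Ly hy] := pI_succ hI r0 jL.
set y := pI r I j in Ly hy *.
have ya : (y != a) by apply: contraTneq Ly => ->; rewrite (negbTE aI) arF.
rewrite /transp (negbTE ya).
(* Bounds valid on I u {r} extend to a because a + 1 obeys them. *)
have ext (P : nat -> bool) : (forall z, (z \in I) || (z == r) -> P z) -> P a ->
    forall z, (z \in symdiff I [fset a]%fset) || (z == r) -> P z.
  by move=> h hPa z; rewrite memJ => /orP[/h//|/eqP->].
case: (eqVneq y a.+1) => [ya1|ya1].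
  split; first by rewrite memJ eqxx orbT.
  rewrite ya1 in hy.
  case: hy => [[jy hy]|hy]; [left; split; first lia|right].
    by apply: (ext (fun z => (z <= j) || (a <= z))%N); [move=> z /hy|]; lia.
  move: (hy _ a1I) => ?.
  by apply: (ext (fun z => a <= z <= j)%N); [move=> z /hy|]; lia.
split; first by rewrite memJ Ly.
case: hy => [[jy hy]|hy]; [left; split; first lia|right].
  by apply: (ext (fun z => (z <= j) || (y <= z))%N) => //; move: (hy _ a1I); lia.
by apply: (ext (fun z => y <= z <= j)%N) => //; move: (hy _ a1I); lia.
Qed.

(** The symmetric difference inserts or deletes a; deletion reduces to insertion
since both sides of the identity are involutive in the change. *)
Lemma transp_pI r I a j : index_set r I -> (1 <= a < r)%N ->
  (a.+1 \in I) || (a.+1 == r) -> (1 <= j <= r)%N ->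
  transp a a.+1 (pI r I j) = pI r (symdiff I [fset a]%fset) j.
Proof.
move=> hI ha a1 hj; have [aI|] := boolP (a \in I); last first.
  by move=> aI; apply: transp_pI_insert.
rewrite -{1}(symdiff1K I a) -transp_pI_insert ?transpK //.
- exact: index_set_symdiff1.
- by rewrite in_symdiff1 aI eqxx.
- by rewrite in_symdiff1 (gtn_eqF (ltnSn a)) addbF.
Qed.

(** * Positive roots and the root order *)

Section TypeDFacts.
Variables (R : realType) (r : nat).
Hypothesis r2 : (1 < r)%N.
Let r0 : (0 < r)%N := ltnW r2.
Local Notation evec := (@evec R r).

Lemma mx_eq_evec (M N : 'M[R]_r) :
  (forall j, (1 <= j <= r)%N -> M *m evec j = N *m evec j) -> M = N.
Proof.
move=> MN; apply/matrixP => i j.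
have delta : evec j.+1 = delta_mx j 0.
  by apply/matrixP => k l; rewrite ord1 !mxE eqxx andbT eqSS.
have /(congr1 (fun c : 'cV[R]_r => c i 0)) := MN j.+1 (ltn_ord j).
by rewrite delta -!colE !mxE.
Qed.

(** The sums of the first [m] coordinates are nonnegative on the simple roots, so
they are nonnegative on positive roots and monotone for the root order: enough to
recognize negative vectors and to locate the roots below a given one. *)
Definition psum (m : nat) (v : 'cV[R]_r) : R := \sum_(i < r | (i < m)%N) v i 0.

Lemma psumD m u v : psum m (u + v) = psum m u + psum m v.
Proof. by rewrite /psum -big_split; apply: eq_bigr => i _; rewrite mxE. Qed.

Lemma psumN m v : psum m (- v) = - psum m v.
Proof. by rewrite /psum -sumrN; apply: eq_bigr => i _; rewrite mxE. Qed.

Lemma psum_evec m j : (1 <= j <= r)%N -> psum m (evec j) = (j <= m)%:R.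
Proof.
case: j => // j /= jr; rewrite /psum big_mkcond (bigD1 (Ordinal jr)) //=.
rewrite !mxE eqxx big1 ?addr0; first by case: ifP.
move=> i ne; rewrite mxE eqSS; case: eqP => [E|_]; last by case: ifP.
by case/eqP: ne; apply: val_inj.
Qed.

Definition psumE := (psumD, psumN, psum_evec).

Lemma pos_roots_psum m v : pos_roots v -> 0 <= psum m v.
Proof.
move=> [i [j [i1 ij jr [->|->]]]]; rewrite !psumE; try lia.
  by rewrite subr_ge0 ler_nat; lia.
by rewrite addr_ge0 ?ler0n.
Qed.

(** The relation [root_le u v] is [nonneg_comb (v - u)] by conversion; the cone is
named so that its closure properties can be used. *)
Definition nonneg_comb (v : 'cV[R]_r) : Prop :=
  exists n : nat -> nat, v = \sum_(1 <= a < r.+1) simple_root R r a *+ n a.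

Lemma nonneg_comb0 : nonneg_comb 0.
Proof. by exists (fun=> 0%N); rewrite big1. Qed.

Lemma nonneg_combD u v : nonneg_comb u -> nonneg_comb v -> nonneg_comb (u + v).
Proof.
move=> [m ->] [n ->]; exists (fun a => m a + n a)%N.
by rewrite -big_split; apply: eq_bigr => a _; rewrite mulrnDr.
Qed.

Lemma nonneg_comb_simple a : (1 <= a <= r)%N -> nonneg_comb (simple_root R r a).
Proof.
move=> ha; exists (eq_op^~ a).
rewrite (bigD1_seq a) ?mem_index_iota ?iota_uniq //= eqxx big1 ?addr0 //.
by move=> b /negbTE->.
Qed.

Lemma nonneg_comb_ind (P : 'cV[R]_r -> Prop) :
  P 0 -> (forall u v, P u -> P v -> P (u + v)) ->
  (forall a, (1 <= a <= r)%N -> P (simple_root R r a)) ->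
  forall v, nonneg_comb v -> P v.
Proof.
move=> P0 PD Ps _ [n ->]; rewrite big_nat; apply: big_ind => // a ha.
by elim: (n a) => [|k IH]; rewrite ?mulr0n // mulrS; apply: PD => //; apply: Ps; lia.
Qed.

Lemma nonneg_comb_minus x y : (1 <= x <= y)%N -> (y <= r)%N ->
  nonneg_comb (evec x - evec y).
Proof.
elim: y => [|y IH] hx hy; first lia.
have [<-|xy] := eqVneq x y.+1; first by rewrite subrr; apply: nonneg_comb0.
rewrite -(subrKA (evec y)); apply: nonneg_combD; first by apply: IH; lia.
have -> : evec y - evec y.+1 = simple_root R r y by rewrite /simple_root ifN //; lia.
by apply: nonneg_comb_simple; lia.
Qed.

Lemma root_le_psum m (u v : 'cV[R]_r) : root_le u v -> psum m u <= psum m v.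
Proof.
rewrite -subr_ge0 -psumN -psumD => h; move: (v - u) (h : nonneg_comb (v - u)).
apply: nonneg_comb_ind => [|w w' hw hw'|a ha].
- by rewrite /psum big1 // => i; rewrite mxE.
- by rewrite psumD addr_ge0.
rewrite /simple_root; case: eqP => ar; rewrite !psumE; try lia.
  by rewrite addr_ge0 ?ler0n.
by rewrite subr_ge0 ler_nat; lia.
Qed.

Lemma root_le_refl (v : 'cV[R]_r) : root_le v v.
Proof. by rewrite /root_le subrr; apply: nonneg_comb0. Qed.

Lemma pos_roots_minus x y : (1 <= x < y)%N -> (y <= r)%N ->
  pos_roots (evec x - evec y).
Proof. by move=> /andP[? ?] ?; exists x, y; split=> //; left. Qed.

Lemma pos_roots_plus x y : (1 <= x < y)%N -> (y <= r)%N ->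
  pos_roots (evec x + evec y).
Proof. by move=> /andP[? ?] ?; exists x, y; split=> //; right. Qed.

Lemma pos_roots_minus_le x y : (1 <= x <= r)%N -> (1 <= y <= r)%N ->
  pos_roots (evec x - evec y) -> (x <= y)%N.
Proof.
move=> hx hy /(pos_roots_psum y); rewrite !psumE // leqnn subr_ge0 ler_nat.
by case: (x <= y)%N.
Qed.

Lemma pos_roots_minusN x y : (1 <= x <= r)%N -> (1 <= y <= r)%N ->
  ~ pos_roots (- evec x - evec y).
Proof.
move=> hx hy /(pos_roots_psum r); rewrite !psumE //.
have /andP[_ ->] := hx; have /andP[_ ->] := hy.
by rewrite -opprD oppr_ge0 leNgt addr_gt0 ?ltr01.
Qed.

(** The full coordinate sum is 0 on e_x - e_y and 2 on sums e_i + e_j, which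
excludes the latter; for differences the sums up to i and up to j - 1 give the
two bounds. *)
Lemma root_le_minus x y (g : 'cV[R]_r) : (1 <= x < y)%N -> (y <= r)%N ->
  pos_roots g -> root_le g (evec x - evec y) ->
  exists x' y', [/\ (x <= x' < y')%N, (y' <= y)%N & g = evec x' - evec y'].
Proof.
move=> hx hy [i [j [i1 ij jr hg]]] le.
have h m := root_le_psum m le.
case: hg h => -> h; last first.
  move: (h r); rewrite !psumE -?natrD ?lerBrDr -?natrD ?ler_nat; lia.
exists i, j; split=> //.
  by move: (h i); rewrite !psumE ?lerBlDr ?lerBrDr -?natrD; try lia;
    rewrite addrAC lerBrDr -!natrD ler_nat; lia.
by move: (h j.-1); rewrite !psumE ?lerBlDr; try lia;
    rewrite addrAC lerBrDr -!natrD ler_nat; lia.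
Qed.

(** * Criteria for rationality *)

Lemma rational_empty k (u : 'M[R]_r) : nu k u = set0 -> is_rational u.
Proof.
move=> nu0; exists k => m /subnK <-; elim: (m - k)%N => [//|n IH].
by rewrite addSn /= IH -subset0 => v [[g [_ [b]]]].
Qed.

(** By induction on k the set S stays inside nu_k. *)
Lemma not_rational_recurrent (u : 'M[R]_r) (S : set 'cV[R]_r) :
  (exists v, S v) ->
  (forall v, S v -> pos_roots v /\ exists2 g, Adj S g & v = u *m g) ->
  ~ is_rational u.
Proof.
move=> [v Sv] hS [N hN].
suff sub k : forall v, S v -> nu k u v.
  by have := sub N _ Sv; rewrite hN.
elim: k => [|k IH] {Sv}v /[dup] Sv /hS[pv [g [pg [b Sb le]] E]];
  split=> //; exists g => //.
by split=> //; exists b => //; apply: IH.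
Qed.

Lemma not_rational_grow (u : 'M[R]_r) (g : 'cV[R]_r) :
  pos_roots g -> pos_roots (u *m g) -> root_le g (u *m g) -> ~ is_rational u.
Proof.
move=> pg pug le; apply: (@not_rational_recurrent _ [set u *m g]).
  by exists (u *m g).
by move=> _ ->; split=> //; exists g => //; split=> //; exists (u *m g).
Qed.

(** * The elements c_I *)

(** The case distinction in the definition of [cI] disappears: for empty I the
cyclic successor in {r} fixes r, which gives w_0. *)
Lemma cI_E I : index_set r I -> cI R r I =
  lin_of_basis (fun j => if j == r then evec (pI r I r) else - evec (pI r I j)).
Proof.
move=> hI; rewrite /cI; case: eqVneq => [I0|I0]; apply: lin_of_basis_ext => j _.
  case: eqP => [_|/eqP jr]; last by rewrite pI_out // I0 inE.
  have [/orP[|/eqP->]//] : cyclic_succ r I r (pI r I r).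
    by apply: pI_succ; rewrite ?eqxx ?orbT.
  by rewrite I0 inE.
by rewrite pI_r.
Qed.

Section FixedI.
Variable I : {fset nat}.
Hypothesis hI : index_set r I.
Local Notation p := (pI r I).

Lemma cI_evec j : (1 <= j < r)%N -> cI R r I *m evec j = - evec (p j).
Proof. by move=> hj; rewrite cI_E // lin_of_basisE ?ifN //; lia. Qed.

Lemma cI_evec_r : cI R r I *m evec r = evec (p r).
Proof. by rewrite cI_E // lin_of_basisE ?eqxx //; lia. Qed.

Lemma pI_in j : j \in I -> [/\ (j < p j)%N, (p j \in I) || (p j == r) &
  forall z, (z \in I) || (z == r) -> (z <= j)%N || (p j <= z)%N].
Proof.
move=> jI; have jL : (j \in I) || (j == r) by rewrite jI.
have [Lp [[]|h]] := pI_succ hI r0 jL => //.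
have := h r; rewrite eqxx orbT => /(_ isT).
by have := hI jI; lia.
Qed.

(** The image is e_(p j) - e_(p i) when j < r, so positivity means p j < p i.  As p
moves indices below r upwards, i must be in I; as p increases on I, j cannot be
in I.  When j = r the image is a negative sum. *)
Lemma cI_minus i j : (1 <= i < j)%N -> (j <= r)%N ->
  pos_roots (cI R r I *m (evec i - evec j)) ->
  [/\ i \in I, j \notin I, (j < p i)%N, (p i <= r)%N &
      cI R r I *m (evec i - evec j) = evec j - evec (p i)].
Proof.
move=> hi hj; have pr k : (1 <= k <= r)%N -> (1 <= p k <= r)%N by apply: pI_range.
have [pi pj] : (1 <= p i <= r)%N /\ (1 <= p j <= r)%N by split; apply: pr; lia.
rewrite mulmxBr cI_evec; last lia.
have prr : (1 <= p r <= r)%N by apply: pr; lia.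
have [->|jr] := eqVneq j r; first by rewrite cI_evec_r => /pos_roots_minusN[].
rewrite cI_evec ?opprK; last lia.
rewrite addrC => /pos_roots_minus_le => /(_ pj pi) le.
have jp : (j <= p j)%N.
  by have [/pI_in[]|jI] := boolP (j \in I); [lia|rewrite pI_out].
have [iI|iI] := boolP (i \in I); last first.
  by move: le; rewrite (pI_out iI); lia.
have [_ piL pimin] := pI_in iI.
have [jI|jI] := boolP (j \in I).
  have [jpj _ _] := pI_in jI.
  by have := pimin j; rewrite jI => /(_ isT); lia.
move: le; rewrite (pI_out jI jr) => le.
split=> //; last by case/andP: pi.
rewrite ltn_neqAle le andbT; apply: contraTneq piL => <-.
by rewrite (negbTE jI) (negbTE jr).
Qed.

(** Among the sums, only e_i + e_r has an image that is not a negative sum. *)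
Lemma nu0_cI : nu 0 (cI R r I) `<=`
  [set v | exists x y, [/\ (1 <= x < y)%N, (y <= r)%N & v = evec x - evec y]].
Proof.
move=> _ [[_ [i [j [i1 ij jr [->|->]]]] <-] pos].
  have hi : (1 <= i < j)%N by lia.
  have [iI jI jpi pir ->] := cI_minus hi jr pos.
  by exists j, (p i); split=> //; lia.
have pr k : (1 <= k <= r)%N -> (1 <= p k <= r)%N by apply: pI_range.
have [pi pj] : (1 <= p i <= r)%N /\ (1 <= p j <= r)%N by split; apply: pr; lia.
move: pos; rewrite /= mulmxDr cI_evec; last lia.
have [jE|jr'] := eqVneq j r; last first.
  by rewrite cI_evec; [move=> /pos_roots_minusN[]|lia].
rewrite jE in ij pj *; rewrite cI_evec_r addrC.
move=> /pos_roots_minus_le => /(_ pj pi) le.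
exists (p r), (p i); split=> //; last by case/andP: pi.
have : p r != p i by apply: contraTneq ij => /pI_inj -> //; rewrite ltnn.
lia.
Qed.

Lemma nu1_cI : nu 1 (cI R r I) `<=` [set v | exists x y,
  [/\ x \in I, (x < y < p x)%N & v = evec y - evec (p x)]].
Proof.
move=> _ [[g [pg [_ /nu0_cI[x [y [hx hy ->]]] le]] <-]].
have [i [j [hi hj ->]]] := root_le_minus hx hy pg le.
case/cI_minus; [lia|lia|] => iI _ jpi _ E.
by exists i, j; split=> //; lia.
Qed.

(** A root below e_y - e_(p x) with x < y < p x starts strictly between x and its
successor, so outside I, and [cI_minus] makes it negative: nu_2 is empty. *)
Lemma rational_cI : is_rational (cI R r I).
Proof.
apply: (@rational_empty 2); rewrite -subset0.
move=> _ [[g [pg [_ /nu1_cI[x [y [xI /andP[xy ypx] ->]]] le]] <-]].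
have [_ _ xmin] := pI_in xI; have x1 := hI xI.
have pr : (1 <= p x <= r)%N by apply: pI_range => //; lia.
have [||i [j [hi hj ->]]] := root_le_minus _ _ pg le; [lia|lia|].
case/cI_minus; [lia|lia|] => iI _ _ _ _.
by have := xmin i; rewrite iI => /(_ isT); lia.
Qed.

Lemma srefl_minus_cI a : (1 <= a < r)%N -> (a.+1 \in I) || (a.+1 == r) ->
  srefl R r a *m cI R r I = cI R r (symdiff I [fset a]%fset).
Proof.
move=> ha a1; have hJ := index_set_symdiff1 hI ha.
apply: mx_eq_evec => j hj; rewrite -mulmxA srefl_minus // (cI_E hJ) // cI_E //.
have pj : (1 <= p j <= r)%N by apply: pI_range.
rewrite !(@lin_of_basisE _ _ _ j) //; case: eqP => [jE|_].
  by rewrite jE in hj pj; rewrite lin_of_basisE // transp_pI.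
by rewrite mulmxN lin_of_basisE // transp_pI.
Qed.

(** As a + 1 is fixed by p, the image of e_(a+1) is - e_a, and the image of e_a is
- e_y with y = p a if a is in I and y = a + 1 otherwise. *)
Lemma not_rational_minus_cI a : (1 <= a <= r - 2)%N -> a.+1 \notin I ->
  ~ is_rational (srefl R r a *m cI R r I).
Proof.
move=> ha a1I.
have [y [hy E]] : exists y, (a < y <= r)%N /\
    srefl R r a *m cI R r I *m (evec a - evec a.+1) = evec a - evec y.
  rewrite mulmxBr -!mulmxA !cI_evec ?opprK; try lia.
  rewrite (pI_out a1I); last lia.
  rewrite srefl_minus ?mulmxN ?opprK; last lia.
  have par : (1 <= p a <= r)%N by apply: pI_range => //; lia.
  rewrite !lin_of_basisE; try lia.
  exists (transp a a.+1 (p a)); split; last by rewrite addrC /transp eqxx gtn_eqF.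
  have [aI|aI] := boolP (a \in I).
    have [apa Lpa _] := pI_in aI.
    have pa1 : p a != a.+1.
      by apply: contraTneq Lpa => ->; rewrite (negbTE a1I); lia.
    by rewrite /transp (gtn_eqF apa) (negbTE pa1); lia.
  by rewrite (pI_out aI) /transp ?eqxx; lia.
apply: (@not_rational_grow _ (evec a - evec a.+1)).
- by apply: pos_roots_minus; lia.
- by rewrite E; apply: pos_roots_minus; lia.
rewrite E; change (nonneg_comb (evec a - evec y - (evec a - evec a.+1))).
rewrite opprB addrC subrKA.
by apply: nonneg_comb_minus; lia.
Qed.

(** As I is not empty, p r is its least element.  If that is below r - 1, then e_r
goes to e_(p r) while e_(r-1) goes to e_(r-1) or to e_r, so e_(r-1) + e_r grows.
Otherwise I = {r - 1}, e_(r-1) is fixed and e_r is negated. *)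
Lemma not_rational_plus_cI : I != fset0 ->
  ~ is_rational (srefl R r r *m cI R r I).
Proof.
move=> I0.
have rI : p r \in I.
  have [||Lp h] := @pI_succ r I r hI _ _; rewrite ?eqxx ?orbT //.
  case/orP: Lp => // /eqP pr; case/fset0Pn: I0 => z zI; have := hI zI.
  by case: h => [[]|/(_ z)]; rewrite ?pr ?ltnn ?zI // => /(_ isT); lia.
have rr := hI rI.
have sr j : (1 <= j <= r)%N -> srefl R r r *m evec j =
    (-1) ^+ (r.-1 <= j)%N *: evec (transp r.-1 r j).
  by move=> hj; rewrite srefl_plus // lin_of_basisE.
set u := srefl R r r *m _.
have ur : u *m evec r = if p r == r.-1 then - evec r else evec (p r).
  rewrite -mulmxA cI_evec_r sr /transp; last lia.
  case: eqP => [->|ne]; first by rewrite leqnn scaleN1r.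
  have lt : (p r < r.-1)%N by lia.
  by rewrite leqNgt lt scale1r ifN //; lia.
have ur1 : u *m evec r.-1 = if r.-1 \in I then evec r.-1 else evec r.
  rewrite -mulmxA cI_evec; last lia.
  have [r1I|r1I] := boolP (r.-1 \in I).
    have -> : p r.-1 = r.
      have [lt Lp _] := pI_in r1I; case/orP: Lp => [/hI|/eqP//]; lia.
    rewrite mulmxN sr /transp; last lia.
    by rewrite eqxx ifN ?leq_pred ?scaleN1r ?opprK //; lia.
  rewrite pI_out //; last lia.
  by rewrite mulmxN sr /transp ?eqxx ?leqnn ?scaleN1r ?opprK //; lia.
have pos_top : pos_roots (evec r.-1 + evec r) by apply: pos_roots_plus; lia.
have uplus : u *m (evec r.-1 + evec r) = u *m evec r.-1 + u *m evec r.
  by rewrite mulmxDr.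
have [prE|prN] := eqVneq (p r) r.-1.
  rewrite prE eqxx in ur; rewrite -prE rI prE in ur1.
  rewrite ur1 ur in uplus.
  have uminus : u *m (evec r.-1 - evec r) = evec r.-1 + evec r.
    by rewrite mulmxBr ur1 ur opprK.
  have pos_minus : pos_roots (evec r.-1 - evec r) by apply: pos_roots_minus; lia.
  apply: (@not_rational_recurrent u
    [set v | v = evec r.-1 + evec r \/ v = evec r.-1 - evec r]).
    by exists (evec r.-1 + evec r); left.
  move=> v [->|->]; split=> //.
    exists (evec r.-1 - evec r) => //; split=> //.
    by exists (evec r.-1 - evec r); [right|apply: root_le_refl].
  exists (evec r.-1 + evec r) => //; split=> //.
  by exists (evec r.-1 + evec r); [left|apply: root_le_refl].
rewrite (negbTE prN) in ur; rewrite ur1 ur in uplus.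
apply: (@not_rational_grow _ (evec r.-1 + evec r)) => //; rewrite uplus.
  by case: ifP => _; rewrite addrC; apply: pos_roots_plus; lia.
case: ifP => _; rewrite /root_le -/(nonneg_comb _).
  rewrite opprD addrACA subrr add0r.
  by apply: nonneg_comb_minus; lia.
rewrite [evec r.-1 + _]addrC opprD addrACA subrr add0r.
by apply: nonneg_comb_minus; lia.
Qed.

End FixedI.

(** * The diagram automorphism *)

(** This reflection in the coordinate r is not in the group W(D_r), but it
normalizes it. *)
Definition flip : 'M[R]_r :=
  lin_of_basis (fun j => if j == r then - evec r else evec j).

Lemma flip_evec j : (1 <= j < r)%N -> flip *m evec j = evec j.
Proof. by move=> hj; rewrite lin_of_basisE ?ifN //; lia. Qed.

Lemma flip_evec_r : flip *m evec r = - evec r.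
Proof. by rewrite lin_of_basisE ?eqxx //; lia. Qed.

Lemma flipK : flip *m flip = 1%:M.
Proof.
apply: mx_eq_evec => j hj; rewrite mul1mx -mulmxA.
have [->|jr] := eqVneq j r; first by rewrite flip_evec_r mulmxN flip_evec_r opprK.
by rewrite !flip_evec //; lia.
Qed.

Lemma flip_pos v : pos_roots v -> pos_roots (flip *m v).
Proof.
move=> [i [j [i1 ij jr hv]]].
have [jE|jN] := eqVneq j r; last first.
  exists i, j; split=> //.
  by case: hv => ->; rewrite ?mulmxDr ?mulmxN !flip_evec; (lia || auto).
rewrite jE in ij hv; exists i, r; split=> //.
by case: hv => ->; rewrite ?mulmxDr ?mulmxN flip_evec_r flip_evec ?opprK; (lia || auto).
Qed.

Lemma simple_root_minus a : (a < r)%N -> simple_root R r a = evec a - evec a.+1.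
Proof. by move=> ar; rewrite /simple_root ltn_eqF. Qed.

Lemma simple_root_r : simple_root R r r = evec r.-1 + evec r.
Proof. by rewrite /simple_root eqxx. Qed.

Lemma flip_nonneg_comb v : nonneg_comb v -> nonneg_comb (flip *m v).
Proof.
move: v; apply: (@nonneg_comb_ind (fun v => nonneg_comb (flip *m v))).
- by rewrite mulmx0; apply: nonneg_comb0.
- by move=> v1 v2 h1 h2; rewrite mulmxDr; apply: nonneg_combD.
move=> a ha; have [->|ar] := eqVneq a r.
  have -> : flip *m simple_root R r r = simple_root R r r.-1.
    rewrite simple_root_r simple_root_minus ?prednK //.
    by rewrite mulmxDr flip_evec_r flip_evec //; lia.
  by apply: nonneg_comb_simple; lia.
have [aE|ar1] := eqVneq a r.-1.
  have -> : flip *m simple_root R r a = simple_root R r r.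
    rewrite simple_root_r simple_root_minus aE ?prednK //.
    by rewrite mulmxBr flip_evec_r flip_evec ?opprK //; lia.
  by apply: nonneg_comb_simple; lia.
have -> : flip *m simple_root R r a = simple_root R r a.
  by rewrite simple_root_minus ?mulmxBr ?flip_evec //; lia.
exact: nonneg_comb_simple.
Qed.

(** Since [flip] preserves the positive roots and the order, conjugation by it
carries the whole construction of nu_k along. *)
Lemma nu_flip k u v : nu k u v -> nu k (flip *m u *m flip) (flip *m v).
Proof.
have conj w : flip *m u *m flip *m (flip *m w) = flip *m (u *m w).
  by rewrite -!mulmxA (mulmxA flip flip) flipK mul1mx.
elim: k v => [|k IH] _ [[g hg <-] pos]; (split; last exact: flip_pos).
  by exists (flip *m g); rewrite ?conj //; apply: flip_pos.
exists (flip *m g); rewrite ?conj //.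
case: hg => pg [b nb le]; split; first exact: flip_pos.
exists (flip *m b); first exact: IH.
by rewrite /root_le -mulmxBr; apply: flip_nonneg_comb.
Qed.

Lemma rational_flip u : is_rational (flip *m u *m flip) <-> is_rational u.
Proof.
have imp w : is_rational (flip *m w *m flip) -> is_rational w.
  move=> [N hN]; exists N => k /hN nu0; rewrite -subset0 => v /nu_flip.
  by rewrite nu0.
split; first exact: imp.
rewrite -{1}(mulmx1 u) -{1}flipK -{1}(mul1mx u) -{1}flipK => h; apply: imp.
by move: h; rewrite !mulmxA.
Qed.

(** The sign of e_r is flipped once before and once after c_I: the image of e_r
changes sign, and so does the image of the last index of I, the one mapped to r. *)
Lemma dI_flip I : index_set r I -> dI R r I = flip *m cI R r I *m flip.
Proof.
move=> hI; apply: mx_eq_evec => j hj; rewrite -!mulmxA.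
rewrite /dI; case: eqVneq => [I0|I0].
  have cE k : (1 <= k < r)%N -> cI R r I *m evec k = - evec k.
    by move=> hk; rewrite cI_evec // pI_out // ?I0 ?inE //; lia.
  have cr : cI R r I *m evec r = evec r.
    by rewrite /cI I0 eqxx lin_of_basisE ?eqxx //; lia.
  rewrite lin_of_basisE //; case: eqP => [->|jr].
    by rewrite flip_evec_r !mulmxN cr flip_evec_r opprK.
  by rewrite !(flip_evec, cE, mulmxN) //; lia.
have lr := last_index_range hI I0.
have pE k : (pI r I k == r) = (k == last_index I).
  by rewrite -{2}(pI_last hI I0) (inj_eq (pI_inj hI)).
have pr k : (1 <= k <= r)%N -> (1 <= pI r I k <= r)%N.
  by apply: pI_range => //; lia.
rewrite lin_of_basisE //; case: (eqVneq j r) => [->|jr].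
  rewrite flip_evec_r !mulmxN cI_evec_r // -(pI_r hI) // flip_evec //.
  have := pE r; have := pr r; lia.
rewrite flip_evec ?cI_evec ?mulmxN //; try lia.
case: eqP => [->|/eqP jl]; first by rewrite pI_last // flip_evec_r opprK.
by rewrite flip_evec //; move: (pE j) (pr j hj); lia.
Qed.

Lemma transp_last_lt a : (a < r.-1)%N -> transp r.-1 r a = a.
Proof. by move=> ha; rewrite /transp !ifN //; lia. Qed.

Lemma transp_last_pred : transp r.-1 r r.-1 = r.
Proof. by rewrite /transp eqxx. Qed.

Lemma transp_last : transp r.-1 r r = r.-1.
Proof. by rewrite /transp eqxx ifN //; lia. Qed.

Lemma srefl_flip a : (1 <= a <= r - 2)%N ->
  srefl R r a = flip *m srefl R r a *m flip.
Proof.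
move=> ha; apply: mx_eq_evec => j hj; rewrite -!mulmxA srefl_minus; last lia.
have [->|jr] := eqVneq j r.
  have t : transp a a.+1 r = r by rewrite /transp !ifN //; lia.
  by rewrite flip_evec_r !mulmxN lin_of_basisE ?t ?flip_evec_r ?opprK //; lia.
have t : (1 <= transp a a.+1 j < r)%N by rewrite /transp; do 2?case: ifP; lia.
by rewrite flip_evec ?(@lin_of_basisE _ _ _ j) ?flip_evec //; lia.
Qed.

Lemma srefl_r_flip : srefl R r r = flip *m srefl R r r.-1 *m flip.
Proof.
apply: mx_eq_evec => j hj; rewrite -!mulmxA srefl_plus // lin_of_basisE //.
have sE k : (1 <= k <= r)%N -> srefl R r r.-1 *m evec k = evec (transp r.-1 r k).
  by move=> hk; rewrite srefl_minus ?lin_of_basisE ?prednK //; lia.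
have [->|jr] := eqVneq j r.
  rewrite flip_evec_r !mulmxN sE ?transp_last ?flip_evec ?leq_pred ?scaleN1r //; lia.
rewrite flip_evec ?sE //; last lia.
have [->|jr1] := eqVneq j r.-1.
  by rewrite transp_last_pred leqnn scaleN1r flip_evec_r.
have lt : (j < r.-1)%N by lia.
by rewrite transp_last_lt // flip_evec 1?leqNgt ?lt ?scale1r //; lia.
Qed.

(** The permutation [transp r.-1 r] of the simple roots is the action of [flip] on
the Dynkin diagram. *)
Lemma srefl_dI I a : index_set r I -> (1 <= a <= r)%N ->
  srefl R r a *m dI R r I =
  flip *m (srefl R r (transp r.-1 r a) *m cI R r I) *m flip.
Proof.
move=> hI ha.
have -> : srefl R r a = flip *m srefl R r (transp r.-1 r a) *m flip.
  rewrite /transp; have [->|ar1] := eqVneq a r.-1.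
    rewrite srefl_r_flip !mulmxA flipK mul1mx.
    by rewrite -mulmxA flipK mulmx1.
  have [->|ar] := eqVneq a r; first exact: srefl_r_flip.
  by apply: srefl_flip; lia.
by rewrite dI_flip // !mulmxA -(mulmxA _ flip flip) flipK mulmx1.
Qed.

(** * Products with simple reflections *)

Lemma cI_Fr I : index_set r I -> Fr (cI R r I).
Proof.
move=> hI; have [->|I0] := eqVneq I fset0; first by left; rewrite /cI eqxx.
by right; exists I; split=> //; left.
Qed.

Lemma dI_Fr I : index_set r I -> Fr (dI R r I).
Proof.
move=> hI; have [->|I0] := eqVneq I fset0; first by left; rewrite /dI eqxx.
by right; exists I; split=> //; right.
Qed.

Lemma cI0 : cI R r fset0 = w0 R r. Proof. by rewrite /cI eqxx. Qed.
Lemma dI0 : dI R r fset0 = w0 R r. Proof. by rewrite /dI eqxx. Qed.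

Lemma symdiff0 a : symdiff fset0 [fset a]%fset = [fset a]%fset.
Proof. by apply/fsetP => z; rewrite in_symdiff1 !inE. Qed.

Lemma srefl_last_cI I : index_set r I ->
  srefl R r (r - 1) *m cI R r I = cI R r (symdiff I [fset (r - 1)%N]%fset).
Proof.
move=> hI; apply: srefl_minus_cI => //; first lia.
by apply/orP; right; lia.
Qed.

Lemma srefl_minus_dI I a : index_set r I -> (1 <= a <= r - 2)%N -> a.+1 \in I ->
  srefl R r a *m dI R r I = dI R r (symdiff I [fset a]%fset).
Proof.
move=> hI ha a1; rewrite srefl_dI ?transp_last_lt //; [|lia|lia].
rewrite srefl_minus_cI ?a1 //; last lia.
by rewrite dI_flip //; apply: index_set_symdiff1 => //; lia.
Qed.

Lemma srefl_plus_dI I : index_set r I ->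
  srefl R r r *m dI R r I = dI R r (symdiff I [fset (r - 1)%N]%fset).
Proof.
move=> hI; rewrite srefl_dI ?leqnn ?r0 // transp_last -subn1.
rewrite srefl_last_cI // dI_flip //; apply: index_set_symdiff1 => //; lia.
Qed.

(** The rational products are again elements c_J, with one exception that needs
the other family: s_r w_0 is the conjugate under [flip] of s_(r-1) w_0. *)
Lemma rational_srefl_cI I a : index_set r I -> (1 <= a <= r)%N ->
  is_rational (srefl R r a *m cI R r I) <->
    ((a <= r - 2)%N /\ a.+1 \in I) \/ a = (r - 1)%N \/ (a = r /\ I = fset0).
Proof.
move=> hI ha; split=> [h|].
  have [a2|a2] := leqP a (r - 2); first left.
    split=> //; apply: contraPT h => a1I.
    by apply: not_rational_minus_cI => //; lia.
  right; have [ar|ar] := eqVneq a r; last by left; lia.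
  right; split=> //; apply/eqP; apply: contraPT h => I0.
  by rewrite ar; apply: not_rational_plus_cI.
have rat_last : is_rational (srefl R r (r - 1) *m cI R r I).
  rewrite srefl_last_cI //; apply: rational_cI => //.
  by apply: index_set_symdiff1 => //; lia.
case=> [[a2 a1]|[->//|[-> I0]]].
  rewrite srefl_minus_cI ?a1 //; last lia.
  by apply: rational_cI => //; apply: index_set_symdiff1 => //; lia.
rewrite I0 cI0 -dI0 -I0 srefl_dI ?transp_last; try lia; last by rewrite I0.
by apply/rational_flip; rewrite -subn1.
Qed.

Lemma rational_srefl_dI I a : index_set r I -> (1 <= a <= r)%N ->
  is_rational (srefl R r a *m dI R r I) <->
    ((a <= r - 2)%N /\ a.+1 \in I) \/ a = r \/ (a = (r - 1)%N /\ I = fset0).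
Proof.
move=> hI ha; rewrite srefl_dI //.
have tr : (1 <= transp r.-1 r a <= r)%N by rewrite /transp; do 2?case: ifP; lia.
apply: (iff_trans (rational_flip _)); apply: (iff_trans (rational_srefl_cI hI tr)).
have [->|ar] := eqVneq a r; first by rewrite transp_last; intuition lia.
have [->|ar1] := eqVneq a r.-1; first by rewrite transp_last_pred; intuition lia.
by rewrite transp_last_lt; [intuition lia|lia].
Qed.

Lemma rational_srefl_cI_Fr I a : index_set r I -> (1 <= a <= r)%N ->
  is_rational (srefl R r a *m cI R r I) -> Fr (srefl R r a *m cI R r I).
Proof.
move=> hI ha /(rational_srefl_cI hI ha)[[a2 a1]|[ar|[-> I0]]].
- rewrite srefl_minus_cI ?a1 //; last lia.
  by apply: cI_Fr; apply: index_set_symdiff1 => //; lia.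
- rewrite ar srefl_last_cI //.
  by apply: cI_Fr; apply: index_set_symdiff1 => //; lia.
- rewrite I0 cI0 -dI0 -I0 srefl_plus_dI //.
  by apply: dI_Fr; apply: index_set_symdiff1 => //; lia.
Qed.

Lemma rational_srefl_dI_Fr I a : index_set r I -> (1 <= a <= r)%N ->
  is_rational (srefl R r a *m dI R r I) -> Fr (srefl R r a *m dI R r I).
Proof.
move=> hI ha /(rational_srefl_dI hI ha)[[a2 a1]|[->|[ar I0]]].
- rewrite srefl_minus_dI ?a1 //; last lia.
  by apply: dI_Fr; apply: index_set_symdiff1 => //; lia.
- rewrite srefl_plus_dI //.
  by apply: dI_Fr; apply: index_set_symdiff1 => //; lia.
- rewrite I0 dI0 -cI0 -I0 ar srefl_last_cI //.
  by apply: cI_Fr; apply: index_set_symdiff1 => //; lia.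
Qed.

End TypeDFacts.

Theorem proposition4p6 (R : realType) (r : nat) (hr5 : (5 <= r)%N)
    (hodd : odd r) :
  (forall (I : {fset nat}) (a : nat), index_set r I -> (1 <= a <= r)%N ->
    (is_rational (srefl R r a *m cI R r I) <->
       ((a <= r - 2)%N /\ a.+1 \in I) \/ a = (r - 1)%N \/
       (a = r /\ I = fset0)) /\
    (is_rational (srefl R r a *m dI R r I) <->
       ((a <= r - 2)%N /\ a.+1 \in I) \/ a = r \/
       (a = (r - 1)%N /\ I = fset0)) /\
    (is_rational (srefl R r a *m cI R r I) -> Fr (srefl R r a *m cI R r I)) /\
    (is_rational (srefl R r a *m dI R r I) -> Fr (srefl R r a *m dI R r I)) /\
    ((a <= r - 2)%N -> a.+1 \in I ->
       srefl R r a *m cI R r I = cI R r (symdiff I [fset a]%fset) /\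
       srefl R r a *m dI R r I = dI R r (symdiff I [fset a]%fset)) /\
    srefl R r (r - 1) *m cI R r I = cI R r (symdiff I [fset (r - 1)%N]%fset) /\
    srefl R r r *m dI R r I = dI R r (symdiff I [fset (r - 1)%N]%fset)) /\
  srefl R r (r - 1) *m w0 R r = cI R r [fset (r - 1)%N]%fset /\
  srefl R r r *m w0 R r = dI R r [fset (r - 1)%N]%fset /\
  (forall (v : 'M[R]_r) (a : nat), (1 <= a <= r)%N -> Fr v ->
     is_rational (srefl R r a *m v) -> Fr (srefl R r a *m v)).
Proof.
have r2 : (1 < r)%N by lia.
have h0 : index_set r fset0 by [].
split.
  move=> I a hI ha; split; first exact: rational_srefl_cI.
  split; first exact: rational_srefl_dI.
  split; first exact: rational_srefl_cI_Fr.
  split; first exact: rational_srefl_dI_Fr.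
  split; last by split; [apply: srefl_last_cI|apply: srefl_plus_dI].
  move=> a2 a1; split; first by rewrite srefl_minus_cI ?a1 //; lia.
  by rewrite srefl_minus_dI //; lia.
split; first by rewrite -cI0 srefl_last_cI ?symdiff0.
split; first by rewrite -dI0 srefl_plus_dI ?symdiff0.
move=> v a ha [->|[J [_ hJ [->|->]]]].
- by rewrite -cI0; apply: rational_srefl_cI_Fr.
- exact: rational_srefl_cI_Fr.
- exact: rational_srefl_dI_Fr.
Qed.
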